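(* Let $p,l$ be two distinct odd prime numbers. Suppose that $p,l\not\equiv 1\pmod 8$ and $p\not\equiv l\pmod 8$. Then there are no commuting quaternions $x\in X_p$, $y\in X_l$.
   Context: $\mathbb{H}(\mathbb{Z})$ is the ring of Hamilton quaternions $x_0+x_1i+x_2j+x_3k$ with integer coefficients ($i^2=j^2=k^2=-1$, $ij=-ji=k$), with norm $|x|^2=x_0^2+x_1^2+x_2^2+x_3^2$. For an odd prime $q$, $X_q$ is the set of $x=x_0+x_1i+x_2j+x_3k\in\mathbb{H}(\mathbb{Z})$ with $|x|^2=q$ such that: $x_0$ is odd and $x_1,x_2,x_3$ are even if $q\equiv 1\pmod 4$; $x_1$ is even and $x_0,x_2,x_3$ are odd if $q\equiv 3\pmod 4$. *)

(* Defs.v *)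
From HB Require Import structures.
From mathcomp Require Import all_boot all_order all_algebra.
From mathcomp Require Import ring.

Set Implicit Arguments.
Unset Strict Implicit.
Unset Printing Implicit Defensive.

Import GRing.Theory.
Local Open Scope ring_scope.

(* Hamilton quaternions x0 + x1 i + x2 j + x3 k over a commutative ring R. *)
Record quaternion (R : Type) : Type :=
  Quaternion { qre : R; qi : R; qj : R; qk : R }.

Definition tuple_of_quaternion (R : Type) (x : quaternion R) : R * R * R * R :=
  (qre x, qi x, qj x, qk x).

Definition quaternion_of_tuple (R : Type) (t : R * R * R * R) : quaternion R :=
  let: (a, b, c, d) := t in Quaternion a b c d.

Lemma tuple_of_quaternionK (R : Type) :
  cancel (@tuple_of_quaternion R) (@quaternion_of_tuple R).
Proof. by case. Qed.

HB.instance Definition _ (R : choiceType) :=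
  Choice.copy (quaternion R) (can_type (@tuple_of_quaternionK R)).

Section QuaternionRing.
Variable R : comNzRingType.
Implicit Types x y z : quaternion R.

Definition addquat x y : quaternion R :=
  Quaternion (qre x + qre y) (qi x + qi y) (qj x + qj y) (qk x + qk y).

Definition oppquat x : quaternion R :=
  Quaternion (- qre x) (- qi x) (- qj x) (- qk x).

(* Bilinear extension of i^2 = j^2 = k^2 = -1, ij = -ji = k. *)
Definition mulquat x y : quaternion R :=
  Quaternion
    (qre x * qre y - qi x * qi y - qj x * qj y - qk x * qk y)
    (qre x * qi y + qi x * qre y + qj x * qk y - qk x * qj y)
    (qre x * qj y - qi x * qk y + qj x * qre y + qk x * qi y)
    (qre x * qk y + qi x * qj y - qj x * qi y + qk x * qre y).

Definition zeroquat : quaternion R := Quaternion 0 0 0 0.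
Definition onequat : quaternion R := Quaternion 1 0 0 0.

Lemma addquatA : associative addquat.
Proof. by move=> x y z; rewrite /addquat /= !addrA. Qed.

Lemma addquatC : commutative addquat.
Proof.
by move=> x y; rewrite /addquat (addrC (qre x)) (addrC (qi x)) (addrC (qj x))
  (addrC (qk x)).
Qed.

Lemma add0quat : left_id zeroquat addquat.
Proof. by case=> a b c d; rewrite /addquat /= !add0r. Qed.

Lemma addNquat : left_inverse zeroquat oppquat addquat.
Proof. by case=> a b c d; rewrite /addquat /= !addNr. Qed.

HB.instance Definition _ :=
  GRing.isZmodule.Build (quaternion R) addquatA addquatC add0quat addNquat.

Lemma mulquatA : associative mulquat.
Proof.
by case=> a b c d [a' b' c' d'] [a'' b'' c'' d'']; congr Quaternion => /=; ring.
Qed.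

Lemma mul1quat : left_id onequat mulquat.
Proof. by case=> a b c d; congr Quaternion => /=; ring. Qed.

Lemma mulquat1 : right_id onequat mulquat.
Proof. by case=> a b c d; congr Quaternion => /=; ring. Qed.

Lemma mulquatDl : left_distributive mulquat addquat.
Proof.
by case=> a b c d [a' b' c' d'] [a'' b'' c'' d'']; congr Quaternion => /=; ring.
Qed.

Lemma mulquatDr : right_distributive mulquat addquat.
Proof.
by case=> a b c d [a' b' c' d'] [a'' b'' c'' d'']; congr Quaternion => /=; ring.
Qed.

Lemma onequat_neq0 : onequat != zeroquat.
Proof. by apply/eqP => -[] /eqP; rewrite oner_eq0. Qed.

HB.instance Definition _ :=
  GRing.Zmodule_isNzRing.Build (quaternion R)
    mulquatA mul1quat mulquat1 mulquatDl mulquatDr onequat_neq0.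

(* The squared norm |x|^2. *)
Definition sqnormquat x : R := qre x ^+ 2 + qi x ^+ 2 + qj x ^+ 2 + qk x ^+ 2.

End QuaternionRing.

Definition evenz (n : int) : bool := (2 %| n)%Z.
Definition oddz (n : int) : bool := ~~ evenz n.

(* Meant for odd q: when q is even both parity conditions are vacuous. *)
Definition X (q : nat) (x : quaternion int) : Prop :=
  [/\ sqnormquat x = q%:Z,
      q = 1 %[mod 4] ->
        [/\ oddz (qre x), evenz (qi x), evenz (qj x) & evenz (qk x)]
    & q = 3 %[mod 4] ->
        [/\ evenz (qi x), oddz (qre x), oddz (qj x) & oddz (qk x)]].

(* Main.v *)
(* Writing u, v for the imaginary parts of x, y: if x and y commute then u and v
   are parallel, so |u|^2 |v|^2 = (u . v)^2. As the real parts are odd,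
   |u|^2 = p - 1 and |v|^2 = l - 1 mod 8, two distinct elements of {2, 4, 6}.
   Their product is then 8 or 12 mod 16, hence not a square. *)

Require Import Defs.
From mathcomp Require Import all_boot all_order all_algebra.
From mathcomp Require Import ring zify.

Import GRing.Theory.
Local Open Scope ring_scope.

Definition imdot (x y : quaternion int) : int :=
  qi x * qi y + qj x * qj y + qk x * qk y.

(** The commutator [x * y - y * x] is twice the cross product of the imaginary parts, which
    therefore vanishes; Lagrange's identity does the rest. *)
Lemma commuting_imdot_sq (x y : quaternion int) :
  x * y = y * x -> imdot x x * imdot y y = imdot x y ^+ 2.
Proof.
case: x y => [a b c d] [a' b' c' d']; rewrite /imdot => -[_ eqi eqj eqk] /=.
have cross_i : c * d' = d * c' by lia.
have cross_j : b * d' = d * b' by lia.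
have cross_k : b * c' = c * b' by lia.
rewrite (_ : _ * _ = (b * b' + c * c' + d * d') ^+ 2 + (c * d' - d * c') ^+ 2
  + (b * d' - d * b') ^+ 2 + (b * c' - c * b') ^+ 2); last by ring.
by rewrite cross_i cross_j cross_k !subrr expr0n /= !addr0.
Qed.

Lemma oddz_sqr (n : int) : oddz n -> exists k : int, n ^+ 2 = 8 * k + 1.
Proof.
rewrite /oddz /evenz => n_odd.
have [m [e|e]] : exists m : int, n = 4 * m + 1 \/ n = 4 * m + 3.
  by exists (n %/ 4)%Z; lia.
- by exists (2 * m ^+ 2 + m); rewrite e; ring.
- by exists (2 * m ^+ 2 + 3 * m + 1); rewrite e; ring.
Qed.

(** Even squares need modulus 16: the values 8 and 12 to be excluded reduce to 0 and 4 mod 8, which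
    squares do attain. *)
Lemma sqr_mod16 (n : int) :
  exists k : int, [\/ n ^+ 2 = 16 * k, n ^+ 2 = 16 * k + 4 | n ^+ 2 = 8 * k + 1].
Proof.
have [n_even|/oddz_sqr[k ->]] := boolP (evenz n); last by exists k; constructor 3.
have [m [e|e]] : exists m : int, n = 4 * m \/ n = 4 * m + 2.
  by exists (n %/ 4)%Z; move: n_even; rewrite /evenz; lia.
- by exists (m ^+ 2); constructor 1; rewrite e; ring.
- by exists (m ^+ 2 + m); constructor 2; rewrite e; ring.
Qed.

(** Both parity patterns in [X] make the real part odd, so its square takes 1 mod 8 away from the
    norm [q]. *)
Lemma X_imdot_mod8 {q : nat} {x : quaternion int} :
  odd q -> X q x -> exists k : int, imdot x x = q%:Z - 1 + 8 * k.
Proof.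
move=> q_odd [normx par1 par3].
have /oddz_sqr[k re_sq] : oddz (qre x).
  have [/par1[]|/par3[]] // : (q = 1 %[mod 4] \/ q = 3 %[mod 4])%N by lia.
by exists (- k); rewrite -normx /sqnormquat re_sq /imdot; ring.
Qed.

Theorem proposition22 (p l : nat)
    (p_prime : prime p) (l_prime : prime l) (p_odd : odd p) (l_odd : odd l)
    (p_neq_l : p <> l)
    (p_mod8 : p <> 1 %[mod 8]) (l_mod8 : l <> 1 %[mod 8])
    (pl_mod8 : p <> l %[mod 8]) :
  ~ exists x y : quaternion int, [/\ X p x, X l y & x * y = y * x].
Proof.
move=> [x [y [Xx Xy /commuting_imdot_sq]]].
have [s ->] := X_imdot_mod8 p_odd Xx; have [t ->] := X_imdot_mod8 l_odd Xy.
(* The residue [i] of [p - 1] mod 8 is even as [p] is odd, and nonzero by [p_mod8]. *)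
have [a [i [pE i_bnd]]] : exists a i : int,
    p%:Z - 1 + 8 * s = 8 * a + i /\ (i = 2 \/ i = 4 \/ i = 6).
  exists ((p%:Z - 1 + 8 * s) %/ 8)%Z, ((p%:Z - 1 + 8 * s) %% 8)%Z; lia.
have [b [j [lE j_bnd]]] : exists b j : int,
    l%:Z - 1 + 8 * t = 8 * b + j /\ (j = 2 \/ j = 4 \/ j = 6).
  exists ((l%:Z - 1 + 8 * t) %/ 8)%Z, ((l%:Z - 1 + 8 * t) %% 8)%Z; lia.
have i_neq_j : i <> j by lia.
(* Since [i] and [j] are even, only [i * j] survives mod 16; being distinct, they give 8, 12 or
   24. *)
rewrite pE lE (_ : _ * _ = 64 * (a * b) + 8 * (a * j) + 8 * (b * i) + i * j);
  last by ring.
have [k] := sqr_mod16 (imdot x y).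
by case=> ->; case: i_bnd i_neq_j => [|[]] ->; case: j_bnd => [|[]] -> // _; lia.
Qed.
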